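(* $\alpha_{\mathbb N}(3)\geq\frac23$ and $\alpha_{\mathbb Z}(3)\geq\frac23$.
   Context: $\mathbb N=\{1,2,\ldots\}$. An $\omega$-permutation of a countably infinite set $S$ of integers is a sequence $p_0,p_1,\ldots$ of elements of $S$ in which every element of $S$ occurs exactly once. It contains a monotone arithmetic progression of length $\ell$ if there are indices $i_0<i_1<\cdots<i_{\ell-1}$, $x\in\mathbb Z$ and $d\in\mathbb Z\setminus\{0\}$ such that $p_{i_j}=x+jd$ for all $0\leq j<\ell$. The set $S$ is $\ell$-permutable if it has an $\omega$-permutation containing no monotone arithmetic progression of length $\ell$. For $S\subseteq\mathbb N$ put $\overline d_{\mathbb N}(S)=\limsup_{n\to\infty}|S\cap[1,n]|/n$, and for $T\subseteq\mathbb Z$ put $\overline d_{\mathbb Z}(T)=\limsup_{n\to\infty}|T\cap[-n,n]|/(2n+1)$. For $X\in\{\mathbb N,\mathbb Z\}$, $$\alpha_X(\ell)=\sup\{\overline d_X(S):S\subseteq X\text{ is infinite and }\ell\text{-permutable}\}.$$ *)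

(* Defs.v *)
From mathcomp Require Import all_boot all_order all_algebra finmap.
From mathcomp Require Import all_classical all_reals all_analysis.

Set Implicit Arguments.
Unset Strict Implicit.
Unset Printing Implicit Defensive.

Import Order.TTheory GRing.Theory Num.Theory.

Local Open Scope classical_set_scope.
Local Open Scope ring_scope.

Definition omega_permutation (S : set int) (p : nat -> int) : Prop :=
  set_bij [set: nat] S p.

Definition has_monotone_AP (l : nat) (p : nat -> int) : Prop :=
  exists (i : 'I_l -> nat) (x d : int),
    [/\ forall a b : 'I_l, (a < b)%N -> (i a < i b)%N,
        d != 0 &
        forall j : 'I_l, p (i j) = x + (j : nat)%:Z * d].

Definition permutable (l : nat) (S : set int) : Prop :=
  exists p : nat -> int, omega_permutation S p /\ ~ has_monotone_AP l p.

(* The positive integers {1, 2, 3, ...}, viewed inside the integers. *)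
Definition posint : set int := [set x | 1 <= x].

(* The term n = 0 is 0 / 0 = 0; it does not affect the limit superior. *)
Definition upper_density_N (R : realType) (S : set int) : \bar R :=
  limn_esup (fun n : nat =>
    (#|` fset_set (S `&` `[1, n%:Z])|%:R / n%:R)%:E).

Definition upper_density_Z (R : realType) (T : set int) : \bar R :=
  limn_esup (fun n : nat =>
    (#|` fset_set (T `&` `[- n%:Z, n%:Z])|%:R / (2 * n + 1)%:R)%:E).

Definition alpha_N (R : realType) (l : nat) : \bar R :=
  ereal_sup [set upper_density_N R S | S in
    [set S | [/\ S `<=` posint, infinite_set S & permutable l S]]].

Definition alpha_Z (R : realType) (l : nat) : \bar R :=
  ereal_sup [set upper_density_Z R S | S in
    [set S | infinite_set S /\ permutable l S]].

(* Main.v *)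
Require Import Defs.
From mathcomp Require Import all_boot all_order all_algebra finmap.
From mathcomp Require Import all_classical all_reals all_analysis.
From mathcomp Require Import zify lra.

Set Implicit Arguments.
Unset Strict Implicit.
Unset Printing Implicit Defensive.

Import Order.TTheory GRing.Theory Num.Theory.

Local Open Scope classical_set_scope.
Local Open Scope ring_scope.

(* The integers y with 4^j < |y| < 2 * 4^j for some j have density 2/3 at the
   scale 2 * 4^J, and doubling such a y leads into the omitted ranges
   2 * 4^j <= |z| <= 4^(j+1). Slightly trimmed, a finite block of these annuli
   thus contains no y, z with x + z = 2y when x lies in an earlier, much smaller
   block; and x + z = 2y with x and y both earlier makes z too small.
   So only progressions inside one block matter, and ordering each block by
   bit reversal (even numbers first, recursively) excludes these, because the
   outer terms of a three-term progression have equal parity. Blocks with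
   exponents in (e, 2e], followed by the next e := 2e + 1, lose a proportion
   O(e / 4^e) of the density. *)

(** * Finite sequences without monotone progressions *)

(** Strictly increasing indices force distinct terms, so difference zero is excluded
    automatically. *)
Definition AP_free (s : seq int) : Prop :=
  {in s & &, forall x y z, (index x s < index y s < index z s)%N ->
    x + z <> y + y}.

(** A triple running from [s] into [t] leaves [s] after its first or its second term; the last two
    hypotheses cover these two cuts. *)
Lemma AP_free_cat (s t : seq int) : AP_free s -> AP_free t ->
  {in s & t & t, forall x y z, x + z <> y + y} ->
  {in s & s & t, forall x y z, x + z <> y + y} ->
  AP_free (s ++ t).
Proof.
move=> sP tP h1 h2 x y z; rewrite !mem_cat !index_cat.
have idx u : u \in s -> (index u s < size s)%N by rewrite index_mem.
case: (boolP (x \in s)) => /= xs; case: (boolP (y \in s)) => /= ys;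
  case: (boolP (z \in s)) => /= zs xt yt zt lt_xyz.
- exact: sP.
- exact: h2.
- by have := idx _ zs; lia.
- exact: h1.
- by have := idx _ ys; lia.
- by have := idx _ ys; lia.
- by have := idx _ zs; lia.
- by apply: tP => //; lia.
Qed.

Lemma AP_free_map (f : int -> int) (s : seq int) : injective f ->
  (forall x y z, f x + f z = f y + f y -> x + z = y + y) ->
  AP_free s -> AP_free (map f s).
Proof.
move=> f_inj fAP sP _ _ _ /mapP[x xs ->] /mapP[y ys ->] /mapP[z zs ->].
by rewrite !index_map // => /sP sxyz /fAP; apply: sxyz.
Qed.

Lemma index_filter_ltn (T : eqType) (a : pred T) (s : seq T) (x y : T) :
  a x -> a y ->
  (index x [seq u <- s | a u] < index y [seq u <- s | a u])%N =
  (index x s < index y s)%N.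
Proof.
move=> ax ay; elim: s => //= u s IHs; case: ifP => au /=.
  by case: (u == x); case: (u == y); rewrite // !ltnS.
have neq v : a v -> (u == v) = false by move=> av; apply: contraFF au => /eqP->.
by rewrite !neq.
Qed.

Lemma AP_free_filter (a : pred int) (s : seq int) :
  AP_free s -> AP_free [seq u <- s | a u].
Proof.
move=> sP x y z; rewrite !mem_filter => /andP[ax xs] /andP[ay ys] /andP[az zs].
by rewrite !index_filter_ltn //; apply: sP.
Qed.


(** * Bit-reversal order *)

(** Starting from -1 and 0 instead of 0 alone makes the recursion reach negative integers as
    well. *)
Fixpoint bit_reversal (k : nat) : seq int :=
  if k is k'.+1 then
    map (fun x => 2 * x) (bit_reversal k') ++
    map (fun x => 2 * x + 1) (bit_reversal k')
  else [:: -1; 0].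

Lemma mem_bit_reversal k x : (x \in bit_reversal k) =
   (- (2 ^ k)%N%:Z <= x < (2 ^ k)%N%:Z).
Proof.
elim: k x => [|k IHk] x; first by rewrite !inE expn0; lia.
rewrite /= mem_cat expnS; apply/orP/idP.
  by case=> /mapP[y]; rewrite IHk => hy ->; lia.
move=> hx; have [x0|x1] : (x = 2 * (x %/ 2)%Z \/ x = 2 * (x %/ 2)%Z + 1) by lia.
  by left; apply/mapP; exists (x %/ 2)%Z; rewrite // IHk; lia.
by right; apply/mapP; exists (x %/ 2)%Z; rewrite // IHk; lia.
Qed.

Lemma bit_reversal_uniq k : uniq (bit_reversal k).
Proof.
elim: k => //= k IHk; rewrite cat_uniq !map_inj_uniq ?IHk /= ?andbT.
- apply/hasPn => _ /mapP[x _ ->]; apply/negP => /mapP[y _]; lia.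
- by move=> x y; lia.
- by move=> x y; lia.
Qed.

(** Each half is an affine image of the previous list. A triple across the halves has [x] even and
    [z] odd, so [x + z] is odd. *)
Lemma AP_free_bit_reversal k : AP_free (bit_reversal k).
Proof.
elim: k => [|k IHk] /=.
  move=> x y z; rewrite !inE => /pred2P[]-> /pred2P[]-> /pred2P[]-> //=.
apply: AP_free_cat.
- by apply: AP_free_map IHk => x y; lia.
- by apply: AP_free_map IHk => x y; lia.
- move=> x y z /mapP[x' _ ->] /mapP[y' _ ->] /mapP[z' _ ->]; lia.
- move=> x y z /mapP[x' _ ->] /mapP[y' _ ->] /mapP[z' _ ->]; lia.
Qed.

(** * From growing finite prefixes to an infinite permutation *)

Lemma prefix_chain (T : eqType) (B : nat -> seq T) :
  (forall n, prefix (B n) (B n.+1)) ->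
  {homo B : m n / (m <= n)%N >-> prefix m n}.
Proof.
by move=> BS; apply: homo_leq => //; [exact: prefix_refl | exact: prefix_trans].
Qed.

(** The limit sequence [p] agrees with each [B n] at the indices of [B n], so a progression in [p]
    already occurs in some [B n]. *)
Lemma permutable_chain (B : nat -> seq int) :
  (forall n, prefix (B n) (B n.+1)) -> (forall n, (n <= size (B n))%N) ->
  (forall n, uniq (B n)) -> (forall n, AP_free (B n)) ->
  permutable 3 [set x | exists n, x \in B n].
Proof.
move=> BS sizeB uniqB BAP; pose p k := nth 0 (B k.+1) k.
have ltk k : (k < size (B k.+1))%N by exact: sizeB.
have pE n k : (k < size (B n))%N -> p k = nth 0 (B n) k.
  move=> ltkn; rewrite /p; have := prefix_chain BS.
  case: (leqP n k.+1) => [le_nk|/ltnW le_kn] homB.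
    by have /prefixP[t ->] := homB _ _ le_nk; rewrite nth_cat ltkn.
  by have /prefixP[t ->] := homB _ _ le_kn; rewrite nth_cat ltk.
have pEle n k : (k < n)%N -> p k = nth 0 (B n) k.
  by move=> lt_kn; apply: pE; apply: leq_trans (sizeB n).
have memp n k : (k < n)%N -> p k \in B n.
  by move=> lt_kn; rewrite (pEle n) // mem_nth // (leq_trans lt_kn).
have indexp n k : (k < n)%N -> index (p k) (B n) = k.
  by move=> lt_kn; rewrite (pEle n) // index_uniq // (leq_trans lt_kn).
exists p; split; first split.
- by move=> k _; exists k.+1; apply: memp.
- move=> i k _ _ eq_p.
  have := indexp (maxn i k).+1 k (leq_maxr i k).
  by rewrite -eq_p indexp // ltnS leq_maxl.
- move=> x [n xBn]; exists (index x (B n)) => //.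
  by rewrite (pE n) ?nth_index ?index_mem.
case=> [i [x [d [i_mono d_neq0 iE]]]].
pose o k (lt_k3 : (k < 3)%N) := Ordinal lt_k3.
have lt01 := i_mono (o 0%N isT) (o 1%N isT) isT.
have lt12 := i_mono (o 1%N isT) (o 2%N isT) isT.
set n := (i (o 2%N isT)).+1.
apply: (BAP n (p (i (o 0%N isT))) (p (i (o 1%N isT))) (p (i (o 2%N isT)))).
1-3: by apply: memp; lia.
- by rewrite !indexp; lia.
- by rewrite !iE /=; lia.
Qed.

(** * Annuli and blocks *)

(* The trimming by [4 ^ e] leaves room for an earlier term [x], [|x| < 4 ^ e]:
   it keeps [2 * y - x] inside the omitted range from [2 * 4 ^ j] to
   [4 ^ j.+1]. *)
Definition annuli (e m : nat) : bool :=
  has (fun j => (4 ^ j + 4 ^ e <= m < 2 * 4 ^ j - 4 ^ e)%N) (iota e.+1 e).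

Lemma annuliP (e m : nat) :
  reflect (exists2 j, (e < j <= e + e)%N &
             (4 ^ j + 4 ^ e <= m < 2 * 4 ^ j - 4 ^ e)%N)
          (annuli e m).
Proof.
by apply: (iffP hasP) => -[j hj mj]; exists j => //; rewrite mem_iota in hj *; lia.
Qed.

(** The lower bound exceeds [|2 * y - x| < 3 * 4 ^ e] for earlier [x] and [y]; the upper bound is
    below [4 ^ (2 * e + 1)], the scale of the next block. *)
Lemma annuli_bounds (e m : nat) :
  annuli e m -> (4 * 4 ^ e < m < 2 * 4 ^ (e + e))%N.
Proof.
case/annuliP=> j /andP[lt_ej le_je] /andP[h1 h2].
have := expn_gt0 4 e.
have : (4 ^ e.+1 <= 4 ^ j)%N by rewrite leq_exp2l.
have : (4 ^ j <= 4 ^ (e + e))%N by rewrite leq_exp2l.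
rewrite expnS; lia.
Qed.

Lemma annuli_double (e : nat) (x y z : int) :
  (`|x| < 4 ^ e)%N -> annuli e `|y| -> annuli e `|z| -> x + z <> y + y.
Proof.
move=> x_lt /annuliP[j _ yj] /annuliP[i _ zi].
(* [|2 * y - x|] lies between [2 * 4 ^ j + 4 ^ e] and [4 ^ j.+1 - 4 ^ e]: [z] is too small if
   [i <= j], too large otherwise. *)
case: (leqP i j) => [le_ij|lt_ji].
  by have : (4 ^ i <= 4 ^ j)%N; [rewrite leq_exp2l | lia].
by have : (4 ^ j.+1 <= 4 ^ i)%N; [rewrite leq_exp2l | rewrite expnS; lia].
Qed.

Fixpoint level (n : nat) : nat :=
  if n is n'.+1 then (level n' + level n').+1 else 1.

Lemma ltn_level n : (n < level n)%N.
Proof. by elim: n => //= n; lia. Qed.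

(** The list reaches [2 ^ (4 * e).+1 = 2 * 4 ^ (e + e)], beyond the last annulus. *)
Definition block (P : pred int) (e : nat) : seq int :=
  [seq x <- bit_reversal (4 * e).+1 | P x && annuli e `|x|%N].

Lemma mem_block P e x : (x \in block P e) = P x && annuli e `|x|%N.
Proof.
rewrite mem_filter mem_bit_reversal; case: (P x) => //=.
case: (boolP (annuli e _)) => // /annuli_bounds; rewrite expnS.
have <- : (4 ^ (e + e) = 2 ^ (4 * e))%N.
  by rewrite -[4%N]/(2 ^ 2)%N -expnM; congr (_ ^ _)%N; lia.
lia.
Qed.

Fixpoint blocks (P : pred int) (n : nat) : seq int :=
  if n is n'.+1 then blocks P n' ++ block P (level n') else [::].

Lemma mem_blocks P n x :
  (x \in blocks P n) <-> P x /\ exists2 m, (m < n)%N & annuli (level m) `|x|%N.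
Proof.
elim: n => [|n IHn] /=; first by split=> [//|[_ []]].
rewrite mem_cat mem_block; split.
  case/orP=> [/IHn[Px [m lt_mn xm]]|/andP[Px xn]]; split=> //.
    by exists m => //; apply: ltnW.
  by exists n.
case=> Px [m]; rewrite ltnS leq_eqVlt => /predU1P[->|lt_mn] xm.
  by rewrite Px xm orbT.
by apply/orP; left; apply/IHn; split=> //; exists m.
Qed.

Lemma blocks_lt P n x : x \in blocks P n -> (`|x| < 4 ^ level n)%N.
Proof.
elim: n x => [//|n IHn] x; rewrite /= mem_cat mem_block => /orP[/IHn|/andP[_]].
  by move=> /leq_trans -> //; rewrite leq_exp2l //; lia.
by move/annuli_bounds; rewrite expnS; lia.
Qed.

Lemma blocks_uniq P n : uniq (blocks P n).
Proof.
elim: n => //= n IHn; rewrite cat_uniq IHn filter_uniq ?bit_reversal_uniq //= andbT.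
apply/hasPn => x; rewrite mem_block => /andP[_ /annuli_bounds xn].
by apply/negP => /blocks_lt; lia.
Qed.

Lemma AP_free_blocks P n : AP_free (blocks P n).
Proof.
elim: n => [|n IHn] //=; apply: AP_free_cat => //.
- exact/AP_free_filter/AP_free_bit_reversal.
- move=> x y z /blocks_lt x_lt; rewrite !mem_block => /andP[_ yn] /andP[_ zn].
  exact: annuli_double x_lt yn zn.
- move=> x y z /blocks_lt x_lt /blocks_lt y_lt; rewrite mem_block.
  by move=> /andP[_ /annuli_bounds zn]; lia.
Qed.

(* [P] is [predT] for subsets of the integers, and positivity for subsets of
   the positive integers. *)
Definition annular_set (P : pred int) : set int :=
  [set x | P x /\ exists n, annuli (level n) `|x|%N].

Lemma permutable_annular (P : pred int) :
  (forall x, 0 < x -> P x) -> permutable 3 (annular_set P).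
Proof.
move=> Ppos.
have -> : annular_set P = [set x | exists n, x \in blocks P n].
  apply/seteqP; split=> x /=.
    by case=> Px [n xn]; exists n.+1; apply/mem_blocks; split=> //; exists n.
  by case=> n /mem_blocks[Px [m _ xm]]; split=> //; exists m.
apply: permutable_chain => [n|n|n|n].
- exact: prefix_prefix.
- elim: n => //= n IHn; rewrite size_cat -addn1 leq_add //.
  set e := level n; have e_gt0 : (0 < e)%N by have := ltn_level n; lia.
  (* The least element of the first annulus shows that every block is nonempty. *)
  have : (4 ^ e.+1 + 4 ^ e)%N%:Z \in block P e.
    rewrite mem_block Ppos ?ltz_nat ?addn_gt0 ?expn_gt0 //=.
    apply/annuliP; exists e.+1; first lia.
    by have := expn_gt0 4 e; rewrite expnS; lia.
  by case: (block P e).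
- exact: blocks_uniq.
- exact: AP_free_blocks.
Qed.

Lemma infinite_permutable (l : nat) (S : set int) :
  permutable l S -> infinite_set S.
Proof.
case=> p [[p_in p_inj _] _] /finite_seqP[s Ss].
have : (size [seq p k | k <- iota 0 (size s).+1] <= size s)%N.
  apply: uniq_leq_size => [|_ /mapP[k _ ->]].
    by rewrite map_inj_uniq ?iota_uniq // => i k; apply: p_inj; rewrite inE.
  by have := p_in k I; rewrite Ss.
by rewrite size_map size_iota ltnn.
Qed.

(** * Counting the elements of a block *)

Lemma leq_size_fset_set (A : set int) (s : seq int) : finite_set A ->
  uniq s -> {in s, forall x, A x} -> (size s <= #|` fset_set A|)%N.
Proof.
move=> finA s_uniq sA; apply: uniq_leq_size => // x /sA Ax.
by rewrite in_fset_set // inE.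
Qed.

Fixpoint annuli_enum (e k : nat) : seq nat :=
  if k is k'.+1 then annuli_enum e k' ++
    iota (4 ^ (e + k) + 4 ^ e) (4 ^ (e + k) - 2 * 4 ^ e)
  else [::].

Lemma mem_annuli_enum e k m : m \in annuli_enum e k ->
  exists2 j, (e < j <= e + k)%N & (4 ^ j + 4 ^ e <= m < 2 * 4 ^ j - 4 ^ e)%N.
Proof.
elim: k => //= k IHk; rewrite mem_cat mem_iota => /orP[/IHk[j hj mj]|mk].
  by exists j => //; lia.
exists (e + k.+1)%N; first lia.
have : (4 ^ e.+1 <= 4 ^ (e + k.+1))%N by rewrite leq_exp2l //; lia.
by rewrite expnS; lia.
Qed.

Lemma annuli_enum_uniq e k : uniq (annuli_enum e k).
Proof.
elim: k => //= k IHk; rewrite cat_uniq IHk iota_uniq andbT /=.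
apply/hasPn => m; rewrite mem_iota => mk; apply/negP => /mem_annuli_enum[j hj mj].
have : (4 ^ j.+1 <= 4 ^ (e + k.+1))%N by rewrite leq_exp2l //; lia.
by rewrite expnS; lia.
Qed.

(** Three times the sum of the [4 ^ j] is [4 ^ (e + k).+1 - 4 ^ e.+1], and trimming costs
    [2 * 4 ^ e] for each of the [k] annuli. *)
Lemma size_annuli_enum e k :
  (4 ^ (e + k).+1 <= 3 * size (annuli_enum e k) + 4 ^ e.+1 + 6 * k * 4 ^ e)%N.
Proof.
elim: k => [|k IHk] /=; first by rewrite addn0; lia.
rewrite size_cat size_iota.
move: IHk; rewrite !addnS !expnS; nia.
Qed.

Lemma annuli_enum_annuli e m : m \in annuli_enum e e -> annuli e m.
Proof. by case/mem_annuli_enum=> j hj mj; apply/annuliP; exists j. Qed.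

(** This bounds the relative trimming loss, of order [e / 4 ^ e], by a multiple of [1 / e.+1]. *)
Lemma sqr_leq_exp4 e : (e.+1 ^ 2 <= 4 ^ e)%N.
Proof. by rewrite -[4%N]/(2 ^ 2)%N -expnM mulnC expnM leq_exp2r // ltn_expl. Qed.

(** * Lower bounds for upper densities *)

Lemma limn_esup_ge (R : realType) (u : nat -> R) (l : R) :
  (forall eps, 0 < eps -> forall m, exists2 n, (m <= n)%N & l - eps <= u n) ->
  (l%:E <= limn_esup (fun n => (u n)%:E))%E.
Proof.
move=> u_ge; apply: le_ereal_inf_tmp => _ [V [m _ mV] <-].
apply/lee_subgt0Pr => eps /u_ge /(_ m)[n le_mn le_u].
apply: (@le_trans _ _ (u n)%:E); first by rewrite -EFinB lee_fin.
by apply: ereal_sup_ubound; exists n => //; apply: mV.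
Qed.

(** The inequality is [c N / D N >= 2 / 3 - 2 / e.+1] cleared of denominators. *)
Lemma limn_esup_ratio_ge (R : realType) (c D : nat -> nat) :
  (forall n, exists N e, [/\ (n <= N)%N, (n <= e)%N, (0 < D N)%N &
     (2 * e.+1 * D N <= 3 * e.+1 * c N + 6 * D N)%N]) ->
  ((2 / 3 : R)%:E <= limn_esup (fun n => ((c n)%:R / (D n)%:R)%:E))%E.
Proof.
move=> cD; apply: limn_esup_ge => eps eps_gt0 m.
have [k k_gt] : exists k : nat, 2 / eps < k%:R.
  by exists (Num.truncn (2 / eps)).+1; rewrite truncnS_gt.
have [N [e [le_N le_e D_gt0 leN]]] := cD (maxn m k).
exists N; first exact: leq_trans (leq_maxl m k) le_N.
have D_pos : 0 < (D N)%:R :> R by rewrite ltr0n.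
rewrite ler_pdivlMr //.
have e_gt : 2 < eps * e.+1%:R.
  rewrite -ltr_pdivrMl // mulrC (lt_le_trans k_gt) // ler_nat.
  by rewrite (leq_trans (leq_maxr m k)) // (leq_trans le_e).
move: leN; rewrite -(ler_nat R) natrD !natrM => leN.
have e1_pos : 0 < e.+1%:R :> R by rewrite ltr0n.
rewrite -(ler_pM2l e1_pos).
have : 0 < (D N)%:R * (eps * e.+1%:R - 2) by rewrite mulr_gt0 // subr_gt0.
nra.
Qed.

Lemma finite_setI_itv (S : set int) (a b : int) : finite_set (S `&` `[a, b]).
Proof.
(* Since [k < 2 ^ k], this list contains the whole interval. *)
apply: sub_finite_set (finite_seq (bit_reversal (`|a| + `|b|)%N)) => x [_].
rewrite /= in_itv mem_bit_reversal /=.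
by have := ltn_expl (`|a| + `|b|)%N (isT : (1 < 2)%N); lia.
Qed.

Lemma upper_density_N_annular (R : realType) (P : pred int) :
  (forall x, 0 < x -> P x) ->
  ((2 / 3 : R)%:E <= upper_density_N R (annular_set P))%E.
Proof.
move=> Ppos.
apply: (limn_esup_ratio_ge _
  (c := fun n => #|` fset_set (annular_set P `&` `[1, n%:Z])|) (D := id)) => n.
(* This bound is where the last annulus of block [n] ends, up to trimming; counting that block alone
   suffices. *)
set e := level n; exists (2 * 4 ^ (e + e))%N, e.
have lt_ne : (n < e)%N := ltn_level n.
have le_eX := sqr_leq_exp4 e.
have XX : (4 ^ (e + e) = 4 ^ e * 4 ^ e)%N by rewrite expnD.
split; [by nia | exact: ltnW | by rewrite muln_gt0 expn_gt0 |].
have := size_annuli_enum e e.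
set N := (2 * 4 ^ (e + e))%N.
set A := annular_set P `&` `[1, N%:Z].
have : (size (annuli_enum e e) <= #|` fset_set A|)%N.
  rewrite -(size_map Posz); apply: leq_size_fset_set.
  - exact: finite_setI_itv.
  - by rewrite map_inj_uniq ?annuli_enum_uniq // => ? ? [].
  - move=> _ /mapP[m /annuli_enum_annuli me ->].
    have := annuli_bounds me => m_bounds; split.
      by split; [apply: Ppos; lia | exists n].
    by rewrite /= in_itv /= /N; lia.
rewrite /N !expnS XX; move: (size _) #|` _| => s c; nia.
Qed.

Lemma upper_density_Z_annular (R : realType) :
  ((2 / 3 : R)%:E <= upper_density_Z R (annular_set predT))%E.
Proof.
apply: (limn_esup_ratio_ge _
  (c := fun n => #|` fset_set (annular_set predT `&` `[- n%:Z, n%:Z])|)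
  (D := fun n => (2 * n + 1)%N)) => n.
set e := level n; exists (2 * 4 ^ (e + e))%N, e.
have lt_ne : (n < e)%N := ltn_level n.
have le_eX := sqr_leq_exp4 e.
have XX : (4 ^ (e + e) = 4 ^ e * 4 ^ e)%N by rewrite expnD.
split; [by nia | exact: ltnW | by rewrite addn1 |].
have := size_annuli_enum e e.
set N := (2 * 4 ^ (e + e))%N.
set A := annular_set predT `&` `[- N%:Z, N%:Z].
have : (2 * size (annuli_enum e e) <= #|` fset_set A|)%N.
  (* The annuli are symmetric, so each enumerated [m] is counted together with [- m]. *)
  have -> : (2 * size (annuli_enum e e) =
    size ([seq Posz m | m <- annuli_enum e e] ++
          [seq - Posz m | m <- annuli_enum e e]))%N.
    by rewrite size_cat !size_map; lia.
  apply: leq_size_fset_set.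
  - exact: finite_setI_itv.
  - rewrite cat_uniq !map_inj_uniq ?annuli_enum_uniq ?andbT /=; last 2 first.
    + by move=> ? ? /oppr_inj[].
    + by move=> ? ? [].
    apply/hasPn => _ /mapP[m /annuli_enum_annuli/annuli_bounds m_bounds ->].
    by apply/negP => /mapP[k _]; lia.
  - move=> x; rewrite mem_cat => /orP[] /mapP[m /annuli_enum_annuli me ->];
      have := annuli_bounds me => m_bounds; split;
      first [by split=> //; exists n; rewrite ?abszN
            | by rewrite /= in_itv /= /N; lia].
rewrite /N !expnS XX; move: (size _) #|` _| => s c; nia.
Qed.

Theorem theorem1p1 (R : realType) :
  ((2 / 3 : R)%:E <= alpha_N R 3)%E /\ ((2 / 3 : R)%:E <= alpha_Z R 3)%E.
Proof.
split.
- pose P : pred int := fun x => 0 < x.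
  have permP : permutable 3 (annular_set P) by exact: permutable_annular.
  apply: le_trans (@upper_density_N_annular R P _) _ => //.
  apply: ereal_sup_ubound; exists (annular_set P) => //; split => //.
    by move=> x [].
  exact: infinite_permutable permP.
- have permT : permutable 3 (annular_set predT) by exact: permutable_annular.
  apply: le_trans (upper_density_Z_annular R) _.
  apply: ereal_sup_ubound; exists (annular_set predT) => //; split => //.
  exact: infinite_permutable permT.
Qed.
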